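(* Let $A$ and $B$ be C$^*$-algebras, where $A$ is unital with unit $1$, and let $T:A\to B$ be a linear map satisfying: (a) for all $a,b\in A$, $ab^*=1$ implies $T(a)T(b)^*=T(1)$; (b) for all $c,d\in A$, $c^*d=0$ implies $T(c)^*T(d)=0$. Then $T$ is a $^*$-homomorphism. *)

(* Defs.v *)
(* Complex numbers are R[i] (mathcomp-real-closed
   complex) for a realType R. *)
From HB Require Import structures.
From mathcomp Require Import all_boot all_order all_algebra.
From mathcomp Require Import all_classical all_reals all_analysis.
From mathcomp Require Export complex.
Import GRing.Theory Num.Theory.
Local Open Scope ring_scope.
Local Open Scope complex_scope.

(* A (not necessarily unital) C*-algebra structure on a complex Banach space V:
   bilinear associative multiplication [mul], a conjugate-linear involutive
   anti-multiplicative involution [star], submultiplicative norm, and the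
   C*-identity ||a* a|| = ||a||^2.  Completeness comes from the type V. *)
Record cstar_axioms (R : realType) (V : completeNormedModType R[i])
    (mul : V -> V -> V) (star : V -> V) : Prop := CStarAxioms {
  cs_mulA : forall a b c, mul a (mul b c) = mul (mul a b) c;
  cs_mulDl : forall a b c, mul (a + b) c = mul a c + mul b c;
  cs_mulDr : forall a b c, mul a (b + c) = mul a b + mul a c;
  cs_mulZl : forall (k : R[i]) a b, mul (k *: a) b = k *: mul a b;
  cs_mulZr : forall (k : R[i]) a b, mul a (k *: b) = k *: mul a b;
  cs_starK : forall a, star (star a) = a;
  cs_starD : forall a b, star (a + b) = star a + star b;
  cs_starZ : forall (k : R[i]) a, star (k *: a) = (k^*)%C *: star a;
  cs_starM : forall a b, star (mul a b) = mul (star b) (star a);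
  cs_norm_mul : forall a b, `|mul a b| <= `|a| * `|b|;
  cs_cstar : forall a, `|mul (star a) a| = `|a| ^+ 2
}.

(* [one] is a (two-sided) multiplicative unit. *)
Definition is_unit_of (R : realType) (V : completeNormedModType R[i])
    (mul : V -> V -> V) (one : V) : Prop :=
  forall a, mul one a = a /\ mul a one = a.
Arguments cstar_axioms {R V}.
Arguments is_unit_of {R V}.

(* Main.v *)
Require Import Defs.
From HB Require Import structures.
From mathcomp Require Import all_boot all_order all_algebra.
From mathcomp Require Import all_classical all_reals all_analysis.
From mathcomp Require Import complex ring lra.
Import Order.TTheory GRing.Theory Num.Theory.
Set Implicit Arguments.
Unset Strict Implicit.
Unset Printing Implicit Defensive.
Local Open Scope ring_scope.
Local Open Scope complex_scope.

(** Put [p = T 1] and [phi x y = T(x^* )^* T(y)].  By (a), [p] is a projection and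
    [T(u) T(u)^* = p] for unitary [u]; since unitaries span, [T] is bounded and
    [p T = T].  By (b), [phi] is a bounded bilinear map vanishing on zero products.
    For its defects [d_f phi (x, y) = phi (x f, y) - phi (x, f y)], linear in [f],
    one has [d_f d_g = 0] whenever [f g = g f = 0].  Applied to [|h| + h] and
    [|h| - h] this gives [d_|h|^2 = d_h^2], so the tent map [F h = 1 - 2|h|]
    satisfies [d_(F h)^2 = 4 d_h^2]; as [F] preserves the self-adjoint unit ball,
    [d_h^2 = 0].  Hence [d_u^2 = 0] for unitary [u], so [phi (x u^n, u^-n y)] is
    affine in [n] and bounded, which forces [d_u = 0].  By linearity
    [phi (x a, y) = phi (x, a y)] for all [a], that is
    [T(a^* )^* T(b) = p T(a b) = T(a b)], and [b = 1] gives [T(a^* )^* = T(a)]. *)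

(** * Real-valued norms and limits with explicit rates *)

Section RealNorm.
Variables (R : realType) (V : normedModType R[i]).
Implicit Types a b : V.

(** The norm of [V] takes values in [R[i]]; its real part loses nothing and makes ordered-field
    reasoning over [R] available. *)
Definition nrm a : R := complex.Re `|a|.

Lemma nrmE a : `|a| = (nrm a)%:C.
Proof. by rewrite /nrm RRe_real// ger0_real. Qed.

Lemma nrm_ge0 a : 0 <= nrm a.
Proof. by rewrite -ler0c -nrmE. Qed.

Lemma nrm0 : nrm 0 = 0.
Proof. by rewrite /nrm normr0. Qed.

Lemma nrm_eq0 a : nrm a <= 0 -> a = 0.
Proof. by rewrite -lecR -nrmE normr_le0 => /eqP. Qed.

Lemma nrmN a : nrm (- a) = nrm a.
Proof. by rewrite /nrm normrN. Qed.

Lemma nrmD a b : nrm (a + b) <= nrm a + nrm b.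
Proof. by rewrite -lecR rmorphD/= -!nrmE ler_normD. Qed.

Lemma nrmB a b : nrm (a - b) <= nrm a + nrm b.
Proof. by rewrite (le_trans (nrmD _ _))// nrmN. Qed.

Lemma nrmZ (k : R) a : nrm (k%:C *: a) = `|k| * nrm a.
Proof.
apply: complexI; rewrite -nrmE normrZ rmorphM/= -nrmE; congr (_ * _).
by rewrite normc_def/= expr0n/= addr0 sqrtr_sqr.
Qed.

Lemma nrmZi a : nrm ('i *: a) = nrm a.
Proof.
apply: complexI; rewrite -!nrmE normrZ normc_def/= expr0n expr1n/= add0r.
by rewrite sqrtr1 mul1r.
Qed.

Lemma nrmMn a n : nrm (a *+ n) = nrm a *+ n.
Proof. by apply: complexI; rewrite -nrmE normrMn nrmE rmorphMn. Qed.

End RealNorm.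

Lemma le_vanishing (R : realType) (a b c : R) :
  (forall n : nat, a <= b + c / n.+1%:R) -> a <= b.
Proof.
move=> H; rewrite leNgt; apply/negP => ba.
have d0 : 0 < a - b by rewrite subr_gt0.
have [n cn] : exists n : nat, c / (a - b) < n.+1%:R.
  exists (Num.truncn (c / (a - b))).
  exact: truncnS_gt.
have := H n; rewrite -lerBlDl ler_pdivlMr ?ltr0Sn// mulrC.
by rewrite -ler_pdivlMr// leNgt cn.
Qed.

Lemma nrm_vanishing (R : realType) (V : normedModType R[i]) (a : V) (c : R) :
  (forall n : nat, nrm a <= c / n.+1%:R) -> a = 0.
Proof.
by move=> H; apply/nrm_eq0/(@le_vanishing _ _ _ c) => n; rewrite add0r.
Qed.

Lemma nrm_cauchy_lim (R : realType) (V : completeNormedModType R[i])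
    (u : nat -> V) (c : R) :
  (forall n m, (n <= m)%N -> nrm (u m - u n) <= c / n.+1%:R) ->
  exists l, forall n, nrm (l - u n) <= (c + 1) / n.+1%:R.
Proof.
move=> uC.
(* A positive element of [R[i]] is real, so the Archimedean property of [R] applies. *)
have small (e : R[i]) : 0 < e -> exists n : nat, (c / n.+1%:R)%:C < e.
  move=> e0; have [r er] : exists r : R, e = r%:C.
    by apply/complex_realP; rewrite gtr0_real.
  move: e0; rewrite er ltcR => r0; exists (Num.truncn (c / r)).
  by rewrite ltcR ltr_pdivrMr ?ltr0Sn// mulrC -ltr_pdivrMr// truncnS_gt.
have cu : cvg (u @ \oo)%classic.
  apply: cauchy_cvg; apply: cauchy_exP => e /small[n ne].
  exists (u n); exists n => // m /= nm.
  rewrite -ball_normE/= distrC nrmE (le_lt_trans _ ne)// lecR.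
  exact: uC.
exists (lim (u @ \oo)%classic) => n.
(* This tolerance for a late term is the extra 1 in [c + 1]. *)
have e0 : 0 < (n.+1%:R^-1 : R)%:C by rewrite ltcR invr_gt0 ltr0Sn.
have /cvgrPdist_lt/(_ _ e0)[m _ Hm] := cu.
have {Hm} := Hm (maxn m n) (leq_maxl _ _); rewrite nrmE ltcR => Hm.
rewrite -(subrK (u (maxn m n)) (lim _)) -addrA (le_trans (nrmD _ _))//.
by rewrite mulrDl mul1r [leRHS]addrC (lerD (ltW Hm))// uC ?leq_maxr.
Qed.

(** * Algebra and norm identities in a C*-algebra *)

Arguments cs_mulA {R V mul star}.
Arguments cs_mulDl {R V mul star}.
Arguments cs_mulDr {R V mul star}.
Arguments cs_mulZl {R V mul star}.
Arguments cs_mulZr {R V mul star}.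
Arguments cs_starK {R V mul star}.
Arguments cs_starD {R V mul star}.
Arguments cs_starZ {R V mul star}.
Arguments cs_starM {R V mul star}.
Arguments cs_norm_mul {R V mul star}.
Arguments cs_cstar {R V mul star}.

Section CStarAlgebra.
Variables (R : realType) (V : completeNormedModType R[i]).
Variables (mul : V -> V -> V) (star : V -> V) (hV : cstar_axioms mul star).
Implicit Types a b c x y z h s : V.
Local Notation "a ** b" := (mul a b) (at level 40, left associativity).

Lemma cs_mul0l a : 0 ** a = 0.
Proof. by have := cs_mulZl hV 0 a a; rewrite !scale0r. Qed.

Lemma cs_mul0r a : a ** 0 = 0.
Proof. by have := cs_mulZr hV 0 a a; rewrite !scale0r. Qed.

Lemma cs_mulNl a b : (- a) ** b = - (a ** b).
Proof. by rewrite -[- a]scaleN1r (cs_mulZl hV) scaleN1r. Qed.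

Lemma cs_mulNr a b : a ** (- b) = - (a ** b).
Proof. by rewrite -[- b]scaleN1r (cs_mulZr hV) scaleN1r. Qed.

Lemma cs_mulBl a b c : (a - b) ** c = a ** c - b ** c.
Proof. by rewrite (cs_mulDl hV) cs_mulNl. Qed.

Lemma cs_mulBr a b c : a ** (b - c) = a ** b - a ** c.
Proof. by rewrite (cs_mulDr hV) cs_mulNr. Qed.

Lemma cs_star0 : star 0 = 0.
Proof. by have := cs_starZ hV 0 0; rewrite conjc0 !scale0r. Qed.

Lemma cs_starZR (k : R) a : star (k%:C *: a) = k%:C *: star a.
Proof. by rewrite (cs_starZ hV) conjc_real. Qed.

Lemma cs_starZi a : star ('i *: a) = - ('i *: star a).
Proof.
rewrite (cs_starZ hV) -scaleNr; congr (_ *: _).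
by apply/eqP; rewrite eq_complex/= oppr0 !eqxx.
Qed.

Lemma cs_starN a : star (- a) = - star a.
Proof. by rewrite -[- a]scaleN1r (cs_starZ hV) rmorphN1 scaleN1r. Qed.

Lemma cs_starB a b : star (a - b) = star a - star b.
Proof. by rewrite (cs_starD hV) cs_starN. Qed.

Lemma nrm_mul a b : nrm (a ** b) <= nrm a * nrm b.
Proof. by rewrite -lecR rmorphM/= -!nrmE (cs_norm_mul hV). Qed.

Lemma nrm_cstar a : nrm (star a ** a) = nrm a ^+ 2.
Proof. by apply: complexI; rewrite rmorphXn/= -!nrmE (cs_cstar hV). Qed.

(** The C*-identity and submultiplicativity give [nrm b ^+ 2 <= nrm (star b) * nrm b]; cancel
    [nrm b], then use this for [a] and for [star a]. *)
Lemma nrm_star a : nrm (star a) = nrm a.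
Proof.
suff le b : nrm b <= nrm (star b).
  apply/eqP; rewrite eq_le le andbT.
  by rewrite -[leRHS](congr1 (@nrm _ _) (cs_starK hV a)) le.
have [b0|b0] := ltP 0 (nrm b); last by rewrite (le_trans b0)// nrm_ge0.
by rewrite -(ler_pM2r b0) -expr2 -nrm_cstar nrm_mul.
Qed.

Lemma nrm_mul_star a : nrm (a ** star a) = nrm a ^+ 2.
Proof. by rewrite -{1}(cs_starK hV a) nrm_cstar nrm_star. Qed.

Lemma nrm_sqr_sa a : star a = a -> nrm (a ** a) = nrm a ^+ 2.
Proof. by move=> sa; rewrite -nrm_cstar sa. Qed.

Definition unitary_of one u := u ** star u = one /\ star u ** u = one.

Variables (one : V) (hone : is_unit_of mul one).

Lemma cs_mul1l a : one ** a = a. Proof. by case: (hone a). Qed.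
Lemma cs_mul1r a : a ** one = a. Proof. by case: (hone a). Qed.

Lemma cs_star1 : star one = one.
Proof.
by rewrite -[LHS]cs_mul1l -{1}(cs_starK hV one) -(cs_starM hV) cs_mul1l (cs_starK hV).
Qed.

(** A self-adjoint idempotent has norm 0 or 1; the value 0 occurs in the zero algebra, hence only an
    inequality. *)
Lemma nrm1_le1 : nrm one <= 1.
Proof.
have := nrm_sqr_sa cs_star1; rewrite cs_mul1l => e.
have := nrm_ge0 one; nra.
Qed.

(* [sqrt_iter x n] increases to the solution [y] of [y = (x + y^2) / 2], that is
   to [1 - sqrt (1 - x)]; the real case [x = 1] dominates all [|x| <= 1]. *)
Fixpoint sqrt_iter x (n : nat) : V :=
  if n is m.+1 then (2^-1)%:C *: (x + sqrt_iter x m ** sqrt_iter x m) else 0.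

Fixpoint sqrt_maj (n : nat) : R :=
  if n is m.+1 then 2^-1 * (1 + sqrt_maj m ^+ 2) else 0.

Lemma sqrt_maj_ge0 n : 0 <= sqrt_maj n.
Proof. by elim: n => //= n IH; nra. Qed.

Lemma sqrt_maj_le1 n : sqrt_maj n <= 1.
Proof. by elim: n => //= n IH; have := sqrt_maj_ge0 n; nra. Qed.

Lemma sqrt_maj_lower n : 1 - 2 / n.+1%:R <= sqrt_maj n.
Proof.
(* The shifted index gives [w <= 1/2] below, so [1 - 2 w] is nonnegative and the induction
   hypothesis can be squared. *)
suff : 1 - 2 / n.+2%:R <= sqrt_maj n.
  apply: le_trans; rewrite lerD2l lerN2 ler_pM2l ?ltr0n//.
  by rewrite lef_pV2 ?posrE ?ltr0n// ler_nat.
elim: n => [|n IH] /=; first by rewrite divff ?subrr.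
set w : R := n.+2%:R^-1 in IH *.
have w0 : 0 < w by rewrite invr_gt0 ltr0n.
have w2 : w <= 2^-1 by rewrite lef_pV2 ?posrE ?ltr0n// ler_nat.
have nw : (n.+2%:R : R) * w = 1 by rewrite mulfV ?pnatr_eq0.
have -> : 2 / n.+3%:R = 2 * (w / (1 + w)) :> R.
  congr (_ * _); apply: (@mulfI _ (n.+3%:R)); first by rewrite pnatr_eq0.
  rewrite mulfV ?pnatr_eq0// -natr1 mulrA mulrDl nw mul1r divff//; lra.
have b1 : w - w ^+ 2 <= w / (1 + w) by rewrite ler_pdivlMr; nra.
have := sqrt_maj_ge0 n; have := sqrt_maj_le1 n; nra.
Qed.

Lemma nrm_half a : nrm ((2^-1)%:C *: a) = 2^-1 * nrm a.
Proof. by rewrite nrmZ ger0_norm// invr_ge0 ler0n. Qed.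

Lemma scale_half a : (2^-1)%:C *: (a + a) = a.
Proof.
rewrite -mulr2n -[a *+ 2]scaler_nat scalerA fmorphV/= rmorph_nat.
by rewrite mulVf ?pnatr_eq0 ?scale1r.
Qed.

Lemma cs_sqr_diff a b : a ** a - b ** b = a ** (a - b) + (a - b) ** b.
Proof. by rewrite cs_mulBr cs_mulBl addrA subrK. Qed.

(** * Square roots of [one - x] by iteration *)

Section SquareRoot.
Variables (x : V) (x1 : nrm x <= 1).
Local Notation y := (sqrt_iter x).

Lemma nrm_sqrt_iter n : nrm (y n) <= sqrt_maj n.
Proof.
elim: n => [|n IH] /=; first by rewrite nrm0.
rewrite nrm_half ler_pM2l ?invr_gt0 ?ltr0n// (le_trans (nrmD _ _))// lerD//.
by rewrite (le_trans (nrm_mul _ _))// expr2 ler_pM// nrm_ge0.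
Qed.

(** By the noncommutative difference of squares, increments of [y] and of [sqrt_maj] obey the same
    recursion, so the bound propagates term by term. *)
Lemma nrm_sqrt_iterS n : nrm (y n.+1 - y n) <= sqrt_maj n.+1 - sqrt_maj n.
Proof.
elim: n => [|n IH]; first by rewrite !subr0 nrm_sqrt_iter.
have -> : y n.+2 - y n.+1 =
    (2^-1)%:C *: (y n.+1 ** (y n.+1 - y n) + (y n.+1 - y n) ** y n).
  by rewrite -cs_sqr_diff /= -scalerBr [x + _]addrC addrKA.
have -> : sqrt_maj n.+2 - sqrt_maj n.+1 = 2^-1 *
    (sqrt_maj n.+1 * (sqrt_maj n.+1 - sqrt_maj n) +
     (sqrt_maj n.+1 - sqrt_maj n) * sqrt_maj n).
  have -> : sqrt_maj n.+2 = 2^-1 * (1 + sqrt_maj n.+1 ^+ 2) by [].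
  have : sqrt_maj n.+1 = 2^-1 * (1 + sqrt_maj n ^+ 2) by [].
  by move: (sqrt_maj n.+1) => t; lra.
rewrite nrm_half ler_pM2l ?invr_gt0 ?ltr0n// (le_trans (nrmD _ _))// lerD//.
- by rewrite (le_trans (nrm_mul _ _))// ler_pM ?nrm_ge0 ?nrm_sqrt_iter.
- by rewrite (le_trans (nrm_mul _ _))// ler_pM ?nrm_ge0 ?nrm_sqrt_iter.
Qed.

(** The increments telescope, and the majorant stays between [1 - 2 / n.+1] and 1 from index [n]
    on. *)
Lemma sqrt_iter_cauchy n m : (n <= m)%N -> nrm (y m - y n) <= 2 / n.+1%:R.
Proof.
move=> /subnK <-; apply: (@le_trans _ _ (sqrt_maj ((m - n) + n) - sqrt_maj n)).
  elim: (m - n)%N => [|k IH]; first by rewrite !subrr nrm0.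
  rewrite addSn -(subrK (y (k + n)) (y _.+1)) -addrA (le_trans (nrmD _ _))//.
  by rewrite (le_trans (lerD (nrm_sqrt_iterS _) IH))// addrA subrK.
have := sqrt_maj_le1 ((m - n) + n); have := sqrt_maj_lower n.
move: (2 / _) => d; lra.
Qed.

Lemma sqrt_iter_star : star x = x -> forall n, star (y n) = y n.
Proof.
move=> sx; elim=> [|n IH] /=; first exact: cs_star0.
by rewrite cs_starZR (cs_starD hV) sx (cs_starM hV) IH.
Qed.

Lemma sqrt_iter_comm z : z ** x = x ** z -> forall n, z ** y n = y n ** z.
Proof.
move=> zx; elim=> [|n IH] /=; first by rewrite cs_mul0l cs_mul0r.
rewrite (cs_mulZl hV) (cs_mulZr hV) (cs_mulDl hV) (cs_mulDr hV) zx.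
by rewrite (cs_mulA hV) IH -(cs_mulA hV) IH (cs_mulA hV).
Qed.

(** The limit [l] of the iterates satisfies [2 l = x + l^2], so [s = one - l] squares to [one - x].
    Self-adjointness and commutation pass from the iterates to [l]. *)
Lemma cs_sqrt : star x = x -> exists s,
  [/\ star s = s, s ** s = one - x, nrm (one - s) <= 1
    & forall z, z ** x = x ** z -> z ** s = s ** z].
Proof.
move=> sx; have [l yl] := nrm_cauchy_lim sqrt_iter_cauchy.
have nl : nrm l <= 1.
  apply: (@le_vanishing _ _ _ (2 + 1)) => n.
  rewrite -(subrK (y n) l) (le_trans (nrmD _ _))// [leRHS]addrC (lerD (yl n))//.
  by rewrite (le_trans (nrm_sqrt_iter n)) ?sqrt_maj_le1.
(* Two consecutive errors are allowed because the recursion links [y n.+1] to [y n]. *)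
have vanish (a : V) (C : R) : 0 <= C ->
    (forall n, nrm a <= C * (nrm (l - y n) + nrm (l - y n.+1))) -> a = 0.
  move=> C0 H; apply: (@nrm_vanishing _ _ _ (C * (3 + 3))) => n.
  rewrite (le_trans (H n))// -mulrA ler_wpM2l// mulrDl lerD//.
    by rewrite (le_trans (yl n))// ler_pM2r ?invr_gt0 ?ltr0n//; lra.
  rewrite (le_trans (yl n.+1))// ler_pM ?addr_ge0 ?invr_ge0 ?ler0n//; first lra.
  by rewrite lef_pV2 ?posrE ?ltr0n// ler_nat.
have el : l + l = x + l ** l.
  apply/eqP; rewrite -subr_eq0; apply/eqP.
  apply: (@vanish _ 2) => [//|n].
  have -> : l + l - (x + l ** l) = (l - y n.+1) + (l - y n.+1)
      - (l ** (l - y n) + (l - y n) ** y n).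
    have dS : y n.+1 + y n.+1 = x + y n ** y n by rewrite -scalerDr scale_half.
    rewrite -cs_sqr_diff addrACA -opprD dS -[RHS]addrA -opprD.
    by rewrite [in RHS](addrACA x) subrr addr0.
  have a1 := nrmB ((l - y n.+1) + (l - y n.+1)) (l ** (l - y n) + (l - y n) ** y n).
  have a2 := nrmD (l - y n.+1) (l - y n.+1).
  have a3 := nrmD (l ** (l - y n)) ((l - y n) ** y n).
  have a4 := nrm_mul l (l - y n).
  have a5 := nrm_mul (l - y n) (y n).
  have a6 := le_trans (nrm_sqrt_iter n) (sqrt_maj_le1 n).
  have := nrm_ge0 (l - y n).
  nra.
exists (one - l); split.
- rewrite cs_starB cs_star1; congr (_ - _).
  apply/eqP; rewrite -subr_eq0; apply/eqP.
  apply: (@vanish _ 2) => [//|n].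
  have -> : star l - l = star (l - y n) - (l - y n).
    by rewrite cs_starB sqrt_iter_star// opprB addrA subrK.
  rewrite (le_trans (nrmB _ _))// nrm_star.
  have := nrm_ge0 (l - y n.+1); have := nrm_ge0 (l - y n); lra.
- have -> : one - x = one - (l + l) + l ** l by rewrite el opprD addrA subrK.
  by rewrite cs_mulBl cs_mul1l cs_mulBr cs_mul1r opprB opprD !addrA addrAC.
- by rewrite subKr.
- move=> z zx; rewrite cs_mulBl cs_mulBr cs_mul1l cs_mul1r; congr (_ - _).
  apply/eqP; rewrite -subr_eq0; apply/eqP.
  apply: (@vanish _ (2 * nrm z)) => [|n]; first by rewrite mulr_ge0 ?nrm_ge0.
  have -> : z ** l - l ** z = z ** (l - y n) - (l - y n) ** z.
    by rewrite cs_mulBl cs_mulBr sqrt_iter_comm// opprB addrA subrK.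
  rewrite (le_trans (nrmB _ _))//.
  have := nrm_mul z (l - y n); have := nrm_mul (l - y n) z.
  have := nrm_ge0 (l - y n.+1); have := nrm_ge0 (l - y n); have := nrm_ge0 z.
  nra.
Qed.

End SquareRoot.

(** * Unitaries, absolute values and spanning *)

Lemma unitary_star u : unitary_of one u -> unitary_of one (star u).
Proof. by case=> u1 u2; split; rewrite (cs_starK hV). Qed.

Lemma nrm_unitary u : unitary_of one u -> nrm u <= 1.
Proof.
move=> [_ u1]; have := nrm_cstar u; rewrite u1; have := nrm1_le1.
have := nrm_ge0 u; nra.
Qed.

(** With [h] as cosine, the sine is [s = sqrt (1 - h^2)]; it commutes with [h] because [h] commutes
    with [h^2]. *)
Lemma cs_sqrt_compl h : star h = h -> nrm h <= 1 -> exists s,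
  [/\ star s = s, h ** s = s ** h, h ** h + s ** s = one
    & unitary_of one (h + 'i *: s)].
Proof.
move=> sh h1.
have [s [ss s2 _ sc]] : exists s, [/\ star s = s, s ** s = one - h ** h,
    nrm (one - s) <= 1 & forall z, z ** (h ** h) = (h ** h) ** z -> z ** s = s ** z].
  by apply: cs_sqrt; [rewrite nrm_sqr_sa// expr_le1// nrm_ge0|rewrite (cs_starM hV) sh].
have hs : h ** s = s ** h by apply: sc; rewrite (cs_mulA hV).
have hh : h ** h + s ** s = one by rewrite s2 addrC subrK.
exists s; split => //.
have ii : 'i * 'i = -1 :> R[i] by rewrite -expr2 sqr_i.
rewrite /unitary_of (cs_starD hV) cs_starZi sh ss !(cs_mulDl hV, cs_mulDr hV).
rewrite !(cs_mulNl, cs_mulNr, cs_mulZl hV, cs_mulZr hV) !scalerA ii hs.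
by rewrite scaleN1r opprK; split; rewrite addrA (subrK, addrK).
Qed.

(** For the unitary [u = h + i s], the sine [s] is [(u - u^* ) / (2 i)], and
    [1 - 2 h^2 = - (u^2 + u^*^2) / 2]. Both are averages of contractions, so no spectral theory is
    involved. *)
Lemma nrm_double_angle h : star h = h -> nrm h <= 1 ->
  nrm (one - h ** h) <= 1 /\ nrm (one - (h ** h + h ** h)) <= 1.
Proof.
move=> sh h1; have [s [ss hs hh uu]] := cs_sqrt_compl sh h1.
have [u1 us1] := (nrm_unitary uu, nrm_unitary (unitary_star uu)).
have mul_le1 a b : nrm a <= 1 -> nrm b <= 1 -> nrm (a ** b) <= 1.
  by move=> a1 b1; rewrite (le_trans (nrm_mul _ _))// mulr_ile1 ?nrm_ge0.
have half_le1 a b : nrm a <= 1 -> nrm b <= 1 -> nrm ((2^-1)%:C *: (a + b)) <= 1.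
  by move=> a1 b1; rewrite nrm_half; have := nrmD a b; lra.
set u := h + 'i *: s in uu u1 us1.
have su : star u = h - 'i *: s by rewrite (cs_starD hV) cs_starZi sh ss.
have ii : 'i * 'i = -1 :> R[i] by rewrite -expr2 sqr_i.
split.
  have -> : one - h ** h = s ** s by rewrite -hh addrC addKr.
  suff s1 : nrm s <= 1 by exact: mul_le1.
  have <- : nrm ((2^-1)%:C *: (u - star u)) = nrm s.
    by rewrite su opprB addrC addrA subrK scale_half nrmZi.
  by apply: half_le1; rewrite ?nrmN.
have e : one - (h ** h + h ** h) = - ((2^-1)%:C *: (u ** u + star u ** star u)).
  have sqrD (w : V) : h ** w = w ** h ->
      (h + w) ** (h + w) = h ** h + w ** w + (h ** w + h ** w).
    by move=> hw; rewrite (cs_mulDl hV) !(cs_mulDr hV) -hw [X in _ + X]addrC addrACA.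
  have hw : h ** ('i *: s) = ('i *: s) ** h by rewrite (cs_mulZl hV) (cs_mulZr hV) hs.
  rewrite su !sqrD ?cs_mulNl ?cs_mulNr ?opprK ?hw//.
  rewrite -opprD addrACA subrr addr0 scale_half.
  rewrite (cs_mulZl hV) (cs_mulZr hV) scalerA ii scaleN1r -hh opprD opprB.
  by rewrite addrACA subrr add0r.
by rewrite e nrmN; apply: half_le1; exact: mul_le1.
Qed.

(** Here [k] is a square root of [h^2 = 1 - (1 - h^2)]. Since [nrm (one - k) <= 1], it has in turn a
    self-adjoint root [z], and the double-angle bound for [z] controls [1 - 2 z^2 = 1 - 2 k]. *)
Lemma cs_abs h : star h = h -> nrm h <= 1 -> exists k,
  [/\ star k = k, k ** k = h ** h, h ** k = k ** h & nrm (one - (k + k)) <= 1].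
Proof.
move=> sh h1; have [h2 _] := nrm_double_angle sh h1.
have [|k [sk k2 k1 kc]] := cs_sqrt h2.
  by rewrite cs_starB cs_star1 (cs_starM hV) sh.
rewrite subKr in k2.
have [|z [sz z2 z1 _]] := cs_sqrt k1.
  by rewrite cs_starB cs_star1 sk.
rewrite subKr in z2.
exists k; split => //.
  by apply: kc; rewrite cs_mulBl cs_mulBr cs_mul1l cs_mul1r (cs_mulA hV).
have nk : nrm k <= 1.
  by rewrite -(@expr_le1 _ 2)// ?nrm_ge0// -nrm_sqr_sa// k2 nrm_sqr_sa// expr_le1 ?nrm_ge0.
have nz : nrm z <= 1 by rewrite -(@expr_le1 _ 2)// ?nrm_ge0// -nrm_sqr_sa// z2.
by rewrite -z2; case: (nrm_double_angle sz nz).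
Qed.

Lemma cs_re_im a : exists h s,
  [/\ a = h + 'i *: s, star h = h, star s = s, nrm h <= nrm a & nrm s <= nrm a].
Proof.
have bnd b : nrm ((2^-1)%:C *: (b + star b)) <= nrm b.
  rewrite nrm_half; have := nrmD b (star b); rewrite nrm_star; lra.
have sa b : star ((2^-1)%:C *: (b + star b)) = (2^-1)%:C *: (b + star b).
  by rewrite cs_starZR (cs_starD hV) (cs_starK hV) addrC.
(* The imaginary part of [a] is the real part of [- i a]. *)
pose b := - ('i *: a).
exists ((2^-1)%:C *: (a + star a)), ((2^-1)%:C *: (b + star b)); split=> //.
  rewrite scalerA mulrC -scalerA -scalerDr /b cs_starN cs_starZi opprK.
  rewrite ['i *: (_ + _)]scalerDr scalerN !scalerA -expr2 sqr_i !scaleN1r opprK.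
  by rewrite addrACA subrr addr0 scale_half.
by rewrite (le_trans (bnd b))// /b nrmN nrmZi.
Qed.

(** A self-adjoint contraction is the average of the unitaries [h + i s] and [h - i s]; scaling and
    real and imaginary parts do the rest. The unitaries come with commuting self-adjoint parts, as
    [defect2_normal] requires. *)
Lemma unitary_span (P : V -> Prop) :
  (forall a b, P a -> P b -> P (a + b)) -> (forall (k : R[i]) a, P a -> P (k *: a)) ->
  (forall h s, star h = h -> star s = s -> h ** s = s ** h ->
    unitary_of one (h + 'i *: s) -> P (h + 'i *: s)) -> forall a, P a.
Proof.
move=> PD PZ Pu.
have sa1 h : star h = h -> nrm h <= 1 -> P h.
  move=> sh h1; have [s [ss hs _ uu]] := cs_sqrt_compl sh h1.
  have su : star (h + 'i *: s) = h + 'i *: - s.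
    by rewrite (cs_starD hV) cs_starZi sh ss scalerN.
  rewrite -(scale_half h).
  have -> : h + h = (h + 'i *: s) + (h + 'i *: - s).
    by rewrite scalerN addrACA subrr addr0.
  apply/PZ/PD; apply: Pu => //.
  - by rewrite cs_starN ss.
  - by rewrite cs_mulNl cs_mulNr hs.
  - by rewrite -su; exact: unitary_star.
have sa h : star h = h -> P h.
  move=> sh; have [/nrm_eq0 ->|h0] := leP (nrm h) 0.
    by apply: sa1; rewrite ?cs_star0 ?nrm0.
  have -> : h = (nrm h)%:C *: ((nrm h)^-1%:C *: h).
    by rewrite scalerA -rmorphM/= mulfV ?gt_eqF// scale1r.
  apply/PZ/sa1; first by rewrite cs_starZR sh.
  by rewrite nrmZ gtr0_norm ?invr_gt0// mulVf ?gt_eqF.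
move=> a; have [h [s [-> sh ss _ _]]] := cs_re_im a.
by apply: PD; [|apply: PZ]; exact: sa.
Qed.

End CStarAlgebra.

(** * Boundedness of linear maps from bounds on unitaries *)

Section BoundedOnUnitaries.
Variables (R : realType) (V : completeNormedModType R[i]) (W : normedModType R[i]).
Variables (mul : V -> V -> V) (star : V -> V) (hV : cstar_axioms mul star).
Variables (one : V) (hone : is_unit_of mul one).

(** Averaging two unitaries bounds [f] by [M] on self-adjoint contractions; the real and imaginary
    parts contribute one [M] each. *)
Lemma bounded_of_unitary (f : {linear V -> W}) (M : R) :
  (forall u, unitary_of mul star one u -> nrm (f u) <= M) ->
  forall a, nrm (f a) <= (M + M) * nrm a.
Proof.
move=> fM.
have sa1 h : star h = h -> nrm h <= 1 -> nrm (f h) <= M.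
  move=> sh h1; have [s [ss _ _ uu]] := cs_sqrt_compl hV hone sh h1.
  have := fM _ (unitary_star hV uu); have := fM _ uu.
  rewrite (cs_starD hV) (cs_starZi hV) sh ss => M1 M2.
  have := nrmD (f (h + 'i *: s)) (f (h - 'i *: s)).
  by rewrite -linearD addrACA subrr addr0 -mulr2n linearMn nrmMn; lra.
have M0 : 0 <= M.
  by apply: le_trans (nrm_ge0 (f 0)) (sa1 _ _ _); rewrite ?(cs_star0 hV) ?nrm0 ?ler01.
have sa h : star h = h -> nrm (f h) <= M * nrm h.
  move=> sh; have [/nrm_eq0 ->|h0] := leP (nrm h) 0.
    by rewrite linear0 !nrm0 mulr0.
  have -> : h = (nrm h)%:C *: ((nrm h)^-1%:C *: h).
    by rewrite scalerA -rmorphM/= mulfV ?gt_eqF// scale1r.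
  rewrite linearZ !nrmZ mulrCA ler_wpM2l//.
  have e1 : `|(nrm h)^-1| * nrm h = 1 by rewrite gtr0_norm ?invr_gt0// mulVf ?gt_eqF.
  by rewrite e1 mulr1; apply: sa1; rewrite ?nrmZ ?e1// (cs_starZR hV) sh.
move=> a; have [h [s [e sh ss ha sa']]] := cs_re_im hV a.
rewrite mulrDl {1}e linearD linearZ (le_trans (nrmD _ _))// nrmZi.
by rewrite lerD// (le_trans (sa _ _))// ler_wpM2l.
Qed.

End BoundedOnUnitaries.

(** * Bilinear maps vanishing on zero products *)

Section ZeroProduct.
Variables (R : realType) (V : completeNormedModType R[i]) (W : normedModType R[i]).
Variables (mul : V -> V -> V) (star : V -> V) (hV : cstar_axioms mul star).
Variables (one : V) (hone : is_unit_of mul one).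
Implicit Types (f g x y : V) (phi : V -> V -> W).
Local Notation "a ** b" := (mul a b) (at level 40, left associativity).

Definition bilin phi :=
  (forall k x x' y, phi (k *: x + x') y = k *: phi x y + phi x' y) /\
  (forall k x y y', phi x (k *: y + y') = k *: phi x y + phi x y').

(* The balance defect of [phi] at [f]. Its linearity in [f] reduces identities
   between values of [phi] to polynomial identities in commuting defects. *)
Definition defect f phi : V -> V -> W := fun x y => phi (x ** f) y - phi x (f ** y).

Lemma defect_def f phi x y : defect f phi x y = phi (x ** f) y - phi x (f ** y).
Proof. by []. Qed.

Lemma bilin_defect f phi : bilin phi -> bilin (defect f phi).
Proof.
move=> [pl pr]; split=> k x y z; rewrite /defect.
  rewrite (cs_mulDl hV) (cs_mulZl hV) !pl scalerBr opprD; exact: addrACA.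
rewrite (cs_mulDr hV) (cs_mulZr hV) !pr scalerBr opprD; exact: addrACA.
Qed.

Lemma defectP phi (k : R[i]) f g : bilin phi -> forall x y,
  defect (k *: f + g) phi x y = k *: defect f phi x y + defect g phi x y.
Proof.
move=> [pl pr] x y; rewrite /defect (cs_mulDr hV) (cs_mulDl hV) (cs_mulZl hV).
rewrite (cs_mulZr hV) pl pr scalerBr opprD; exact: addrACA.
Qed.

Lemma bilin0l phi y : bilin phi -> phi 0 y = 0.
Proof. by move=> [pl _]; have := pl (-1) 0 0 y; rewrite scaler0 add0r scaleN1r addNr. Qed.

Lemma bilin0r phi x : bilin phi -> phi x 0 = 0.
Proof. by move=> [_ pr]; have := pr (-1) x 0 0; rewrite scaler0 add0r scaleN1r addNr. Qed.

Lemma defect1 phi : forall x y, defect one phi x y = 0.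
Proof. by move=> x y; rewrite /defect (cs_mul1l hone) (cs_mul1r hone) subrr. Qed.

Lemma defect0 phi : bilin phi -> forall x y, defect 0 phi x y = 0.
Proof.
by move=> bp x y; rewrite /defect (cs_mul0l hV) (cs_mul0r hV) bilin0l// bilin0r// subrr.
Qed.

Lemma defectD phi f g : bilin phi -> forall x y,
  defect (f + g) phi x y = defect f phi x y + defect g phi x y.
Proof. by move=> bp x y; rewrite -{1}(scale1r f) defectP// scale1r. Qed.

Lemma defectZ phi (k : R[i]) f : bilin phi -> forall x y,
  defect (k *: f) phi x y = k *: defect f phi x y.
Proof. by move=> bp x y; rewrite -{1}[k *: f]addr0 defectP// defect0// addr0. Qed.

Lemma defectN phi f : bilin phi -> forall x y,
  defect (- f) phi x y = - defect f phi x y.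
Proof. by move=> bp x y; rewrite -[- f]scaleN1r defectZ// scaleN1r. Qed.

Definition defect2 f g phi := defect f (defect g phi).

Lemma defect2E f g phi x y : defect2 f g phi x y =
  phi (x ** f ** g) y - phi (x ** f) (g ** y) - phi (x ** g) (f ** y) +
  phi x (g ** (f ** y)).
Proof. by rewrite /defect2 /defect opprB addrA addrAC. Qed.

Lemma defect2C f g phi : f ** g = g ** f -> forall x y,
  defect2 f g phi x y = defect2 g f phi x y.
Proof.
move=> fg x y; rewrite !defect2E -!(cs_mulA hV x) !(cs_mulA hV _ _ y) fg.
by congr (_ + _); rewrite addrAC.
Qed.

Section Defect2.
Variables (phi : V -> V -> W) (bp : bilin phi).

Lemma defect2Dl f f' g x y :
  defect2 (f + f') g phi x y = defect2 f g phi x y + defect2 f' g phi x y.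
Proof. by rewrite /defect2 defectD//; exact: bilin_defect. Qed.

Lemma defect2Nl f g x y : defect2 (- f) g phi x y = - defect2 f g phi x y.
Proof. by rewrite /defect2 defectN//; exact: bilin_defect. Qed.

Lemma defect2Zl k f g x y : defect2 (k *: f) g phi x y = k *: defect2 f g phi x y.
Proof. by rewrite /defect2 defectZ//; exact: bilin_defect. Qed.

Lemma defect21l g x y : defect2 one g phi x y = 0.
Proof. exact: defect1. Qed.

Lemma defect2Dr f g g' x y :
  defect2 f (g + g') phi x y = defect2 f g phi x y + defect2 f g' phi x y.
Proof. by rewrite /defect2 !(defect_def f) !defectD// opprD addrACA. Qed.

Lemma defect2Zr k f g x y : defect2 f (k *: g) phi x y = k *: defect2 f g phi x y.
Proof. by rewrite /defect2 !(defect_def f) !defectZ// -scalerBr. Qed.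

Lemma defect2Nr f g x y : defect2 f (- g) phi x y = - defect2 f g phi x y.
Proof. by rewrite -[- g]scaleN1r defect2Zr scaleN1r. Qed.

Lemma defect21r f x y : defect2 f one phi x y = 0.
Proof. by rewrite /defect2 {1}/defect !defect1 subrr. Qed.

End Defect2.

Section Balanced.
Variables (phi : V -> V -> W) (bp : bilin phi) (K : R) (K0 : 0 <= K).
Hypothesis phiK : forall x y, nrm (phi x y) <= K * (nrm x * nrm y).
Hypothesis phi0 : forall x y, x ** y = 0 -> phi x y = 0.

(** Of the four terms of [defect2E], the outer two have a zero argument and the mixed two have
    arguments with zero product. *)
Lemma defect2_orth f g : f ** g = 0 -> g ** f = 0 ->
  forall x y, defect2 f g phi x y = 0.
Proof.
move=> fg gf x y; rewrite defect2E.
rewrite -(cs_mulA hV x) fg (cs_mulA hV g) gf (cs_mul0l hV) (cs_mul0r hV).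
rewrite bilin0l// bilin0r// !phi0 ?subr0 ?addr0//.
  by rewrite (cs_mulA hV) -(cs_mulA hV x) gf (cs_mul0r hV) (cs_mul0l hV).
by rewrite (cs_mulA hV) -(cs_mulA hV x) fg (cs_mul0r hV) (cs_mul0l hV).
Qed.

(** The elements [k + h] and [k - h] are orthogonal; in the expanded second defect the cross terms
    cancel by commutation. *)
Lemma defect2_abs h k : k ** k = h ** h -> h ** k = k ** h ->
  forall x y, defect2 k k phi x y = defect2 h h phi x y.
Proof.
move=> kh hk x y.
have := @defect2_orth (k + h) (k - h) _ _ x y.
rewrite defect2Dl// !defect2Dr// !defect2Nr// (defect2C phi hk).
rewrite addrA subrK => H; apply/eqP; rewrite -subr_eq0; apply/eqP; apply: H.
  by rewrite (cs_mulDl hV) !(cs_mulBr hV) hk kh addrA subrK subrr.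
by rewrite (cs_mulBl hV) !(cs_mulDr hV) hk kh opprD addrA addrK subrr.
Qed.

Lemma defect_bound psi f (L : R) : 0 <= L -> nrm f <= 1 ->
  (forall x y, nrm (psi x y) <= L * (nrm x * nrm y)) ->
  forall x y, nrm (defect f psi x y) <= (L + L) * (nrm x * nrm y).
Proof.
move=> L0 f1 psiL x y; rewrite mulrDl (le_trans (nrmB _ _))// lerD//.
  rewrite (le_trans (psiL _ _))// ler_wpM2l// ler_wpM2r ?nrm_ge0//.
  by rewrite (le_trans (nrm_mul hV _ _))// ler_piMr ?nrm_ge0.
rewrite (le_trans (psiL _ _))// ler_wpM2l// ler_wpM2l ?nrm_ge0//.
by rewrite (le_trans (nrm_mul hV _ _))// ler_piMl ?nrm_ge0.
Qed.

(* The tent map [h |-> 1 - 2|h|] preserves the self-adjoint unit ball and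
   multiplies the second defect by 4, which boundedness forbids unless it is 0. *)
Lemma defect2_sa1 h : star h = h -> nrm h <= 1 ->
  forall x y, defect2 h h phi x y = 0.
Proof.
move=> sh h1 x y; set C := (K + K + (K + K)) * (nrm x * nrm y).
have pow4 n : forall g, star g = g -> nrm g <= 1 ->
    nrm (defect2 g g phi x y *+ 4 ^ n) <= C.
  elim: n => [|n IH] g sg g1.
    apply: defect_bound => //; first by rewrite addr_ge0.
    exact: defect_bound.
  have [k [sk k2 gk F1]] := cs_abs hV hone sg g1.
  have F2 : defect2 (one - (k + k)) (one - (k + k)) phi x y =
      defect2 g g phi x y *+ 4.
    rewrite defect2Dl// defect21l// add0r defect2Nl// defect2Dr// defect21r// add0r.
    rewrite defect2Nr// opprK defect2Dl// !defect2Dr// (defect2_abs k2 gk).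
    by rewrite -!mulr2n -mulrnA.
  rewrite expnS mulrnA -F2; apply: IH => //.
  by rewrite (cs_starB hV) (cs_star1 hV hone) (cs_starD hV) sk.
(* Only [n < 4 ^ n] is needed from the exponential growth. *)
apply: (@nrm_vanishing _ _ _ C) => n.
have := pow4 n h sh h1; rewrite nrmMn ler_pdivlMr ?ltr0n// => /(le_trans _); apply.
by rewrite -[_ *+ 4 ^ n]mulr_natr ler_wpM2l ?nrm_ge0// ler_nat ltn_expl.
Qed.

Lemma defect2_sa h : star h = h -> forall x y, defect2 h h phi x y = 0.
Proof.
move=> sh x y; have [/nrm_eq0 ->|h0] := leP (nrm h) 0.
  by apply: defect2_sa1; rewrite ?(cs_star0 hV) ?nrm0.
have -> : h = (nrm h)%:C *: ((nrm h)^-1%:C *: h).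
  by rewrite scalerA -rmorphM/= mulfV ?gt_eqF// scale1r.
rewrite defect2Zl// defect2Zr// defect2_sa1 ?scaler0//.
  by rewrite (cs_starZR hV) sh.
by rewrite nrmZ gtr0_norm ?invr_gt0// mulVf ?gt_eqF.
Qed.

(** Polarization: the squares of the defects at [h], [s] and [h + s] vanish, so twice the mixed term
    does too. *)
Lemma defect2_normal h s : star h = h -> star s = s -> h ** s = s ** h ->
  forall x y, defect2 (h + 'i *: s) (h + 'i *: s) phi x y = 0.
Proof.
move=> sh ss hs x y.
have d0 : defect2 h s phi x y = 0.
  have := @defect2_sa (h + s) _ x y; rewrite (cs_starD hV) sh ss => /(_ erefl).
  rewrite defect2Dl// !defect2Dr// !defect2_sa// add0r addr0 (defect2C phi hs).
  move=> e; apply: nrm_eq0; have := congr1 (@nrm _ _) e.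
  by rewrite -mulr2n nrmMn nrm0; lra.
rewrite defect2Dl// !defect2Dr// !defect2Zl// !defect2Zr// !defect2_sa//.
by rewrite (defect2C phi (esym hs)) d0 !scaler0 !addr0.
Qed.

(* [phi (x u^n) (u^-n z) = phi x z + n * defect u phi x (u^-1 z)] is bounded in [n]. *)
Lemma defect_unitary u : unitary_of mul star one u ->
  (forall x y, defect2 u u phi x y = 0) -> forall x y, defect u phi x y = 0.
Proof.
move=> uu d0.
have [u1 u2] := uu; have nu := nrm_unitary hV hone uu.
have nsu := nrm_unitary hV hone (unitary_star hV uu).
have stepG x z : defect u phi (x ** u) (star u ** z) = defect u phi x z.
  apply/eqP; rewrite -subr_eq0; have := d0 x (star u ** z).
  by rewrite /defect2 (defect_def u) (cs_mulA hV u) u1 (cs_mul1l hone) => ->.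
have step x z : phi (x ** u) (star u ** z) = phi x z + defect u phi x (star u ** z).
  by rewrite /defect (cs_mulA hV u) u1 (cs_mul1l hone) addrC subrK.
(* The witnesses are [x u^n] and [u^-n z]; only their norm bounds are kept. *)
have iter n : forall x z, exists x' z', [/\ nrm x' <= nrm x, nrm z' <= nrm z
    & phi x' z' = phi x z + defect u phi x (star u ** z) *+ n].
  elim: n => [|n IH] x z; first by exists x, z; rewrite mulr0n addr0.
  have [x' [z' [x'x z'z e]]] := IH (x ** u) (star u ** z).
  exists x', z'; split.
  - by rewrite (le_trans x'x)// (le_trans (nrm_mul hV _ _))// ler_piMr ?nrm_ge0.
  - by rewrite (le_trans z'z)// (le_trans (nrm_mul hV _ _))// ler_piMl ?nrm_ge0.
  - rewrite e stepG step mulrS; exact/esym/addrA.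
move=> x y; have -> : y = star u ** (u ** y).
  by rewrite (cs_mulA hV) u2 (cs_mul1l hone).
set z := u ** y.
apply: (@nrm_vanishing _ _ _ (K * (nrm x * nrm z) + K * (nrm x * nrm z))) => n.
have [x' [z' [x'x z'z e]]] := iter n.+1 x z.
rewrite ler_pdivlMr ?ltr0n// mulr_natr -nrmMn.
have -> : defect u phi x (star u ** z) *+ n.+1 = phi x' z' - phi x z.
  by rewrite e addrC addKr.
rewrite (le_trans (nrmB _ _))// lerD// (le_trans (phiK _ _))//.
by rewrite ler_wpM2l// ler_pM ?nrm_ge0.
Qed.

Lemma zero_product_balanced a x y : phi (x ** a) y = phi x (a ** y).
Proof.
apply/eqP; rewrite -subr_eq0; apply/eqP; move: a x y.
apply: (unitary_span hV hone) => [a b Pa Pb x y|k a Pa x y|h s sh ss hs uu].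
- by rewrite -[LHS](defect_def (a + b)) defectD// /defect Pa Pb addr0.
- by rewrite -[LHS](defect_def (k *: a)) defectZ// /defect Pa scaler0.
- exact: (defect_unitary uu (defect2_normal sh ss hs)).
Qed.

End Balanced.
End ZeroProduct.

(** * From balanced forms to star-homomorphisms *)

Theorem theorem2p9 (R : realType)
  (A : completeNormedModType R[i]) (mulA : A -> A -> A) (starA : A -> A)
  (hA : cstar_axioms mulA starA) (oneA : A) (hone : is_unit_of mulA oneA)
  (B : completeNormedModType R[i]) (mulB : B -> B -> B) (starB : B -> B)
  (hB : cstar_axioms mulB starB)
  (T : {linear A -> B})
  (ha : forall a b : A, mulA a (starA b) = oneA ->
          mulB (T a) (starB (T b)) = T oneA)
  (hb : forall c d : A, mulA (starA c) d = 0 ->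
          mulB (starB (T c)) (T d) = 0) :
  (forall a b : A, T (mulA a b) = mulB (T a) (T b)) /\
  (forall a : A, T (starA a) = starB (T a)).
Proof.
pose p := T oneA.
have pp' : mulB p (starB p) = p by apply: ha; rewrite (cs_star1 hA hone) (cs_mul1l hone).
have sp : starB p = p by rewrite -pp' (cs_starM hB) (cs_starK hB).
have pp : mulB p p = p by rewrite -{2}sp.
have pT a : mulB p (T a) = T a.
  move: a; apply: (unitary_span hA hone) => [a b pa pb|k a pa|h s _ _ _ [uu _]].
  - by rewrite linearD (cs_mulDr hB) pa pb.
  - by rewrite linearZ/= (cs_mulZr hB) pa.
  set u := h + _ in uu *; have tt := ha _ _ uu; rewrite -/p in tt.
  apply/eqP; rewrite -subr_eq0; apply/eqP/nrm_eq0.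
  (* Since [T u] times its adjoint is [p], this product expands to [p - p - p + p]. *)
  have : nrm (mulB (mulB p (T u) - T u) (starB (mulB p (T u) - T u))) = 0.
    rewrite (cs_starB hB) (cs_starM hB) sp (cs_mulBl hB) !(cs_mulBr hB).
    rewrite -!(cs_mulA hB p) !(cs_mulA hB (T u)) tt !pp subrr.
    by rewrite nrm0.
  rewrite (nrm_mul_star hB) => /eqP; rewrite expf_eq0/= => /eqP ->.
  exact: lexx.
have Tu u : unitary_of mulA starA oneA u -> nrm (T u) <= 1.
  move=> [uu _]; have p1 : nrm p <= 1.
    by have := nrm_sqr_sa hB sp; rewrite pp; have := nrm_ge0 p; nra.
  have := nrm_mul_star hB (T u); rewrite (ha _ _ uu) -/p; have := nrm_ge0 (T u); nra.
have TK := bounded_of_unitary hA hone Tu.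
(* The two stars make [phi] linear in [x] and turn hypothesis (b) into vanishing on zero
   products. *)
pose phi x y := mulB (starB (T (starA x))) (T y).
have bphi : bilin phi.
  split=> k x y z; rewrite /phi.
    rewrite (cs_starD hA) (cs_starZ hA) linearD linearZ/= (cs_starD hB) (cs_starZ hB).
    by rewrite conjcK (cs_mulDl hB) (cs_mulZl hB).
  by rewrite linearD linearZ/= (cs_mulDr hB) (cs_mulZr hB).
(* The constant is [(1 + 1)^2], one factor [1 + 1] from [TK] for each argument. *)
have phiK x y : nrm (phi x y) <= 4 * (nrm x * nrm y).
  rewrite (le_trans (nrm_mul hB _ _))// (nrm_star hB).
  have := TK (starA x); have := TK y; rewrite (nrm_star hA).
  have := nrm_ge0 (T y); have := nrm_ge0 (T (starA x)); have := nrm_ge0 x; have := nrm_ge0 y.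
  nra.
have phi0 x y : mulA x y = 0 -> phi x y = 0.
  by move=> xy; apply: hb; rewrite (cs_starK hA).
have bal := zero_product_balanced hA hone bphi (ler0n _ 4) phiK phi0.
have key a b : mulB (starB (T (starA a))) (T b) = T (mulA a b).
  have := bal a oneA b; rewrite /phi (cs_mul1l hone) => ->.
  by rewrite (cs_star1 hA hone) -/p sp pT.
(* Taking [b = 1] leaves a factor [p] on the right, absorbed by the adjoint of [pT]. *)
have TS a : starB (T (starA a)) = T a.
  have := key a oneA; rewrite (cs_mul1r hone) -/p => <-.
  by rewrite -[in RHS]sp -(cs_starM hB) pT.
split=> [a b|a]; first by rewrite -key TS.
by rewrite -[RHS](congr1 starB (TS a)) (cs_starK hB).
Qed.
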